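(* Let $L=[a,b]$ be a closed interval of $\overline{\mathbb{R}}=\mathbb{R}\cup\{-\infty,+\infty\}$, let $n\geqslant 1$, let $p:L^n\to L$ be a weighted lattice polynomial function, and let $X_1,\ldots,X_n$ be independent $L$-valued random variables, $X_i$ having cumulative distribution function $F_i(y)=\Pr[X_i\leqslant y]$. Then the cumulative distribution function $F_p(y)=\Pr[Y_p\leqslant y]$ of the random variable $Y_p:=p(X_1,\ldots,X_n)$ is given, for every $y\in\mathbb{R}$, by each of the following formulas: $$F_p(y)= 1-\sum_{S\subseteq [n]} \big[1-H_{p(\mathbf{e}_S)}(y)\big]\prod_{i\in [n]\setminus S}F_i(y)\,\prod_{i\in S}[1-F_i(y)],$$ $$F_p(y)= \sum_{S\subseteq [n]}H_{p(\mathbf{e}_{[n]\setminus S})}(y)\,\prod_{i\in S}F_i(y)\,\prod_{i\in [n]\setminus S}[1-F_i(y)].$$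
   Context: Notation: $[n]=\{1,\ldots,n\}$; $\wedge=\min$, $\vee=\max$. The class of weighted lattice polynomial functions from $L^n$ to $L$ is the smallest class of functions $L^n\to L$ that contains all projections $(x_1,\ldots,x_n)\mapsto x_k$ ($k\in[n]$) and all constant functions $(x_1,\ldots,x_n)\mapsto c$ ($c\in L$), and is closed under pointwise $\wedge$ and pointwise $\vee$. For $S\subseteq[n]$, $\mathbf{e}_S\in\{a,b\}^n$ is the vector whose $i$th component is $b$ if $i\in S$ and $a$ otherwise. For $c\in\overline{\mathbb{R}}$, $H_c(y):=H(y-c)$ where $H$ is the Heaviside function with $H(x)=1$ if $x\geqslant 0$ and $H(x)=0$ otherwise; that is, $H_c(y)=1$ if $y\geqslant c$ and $H_c(y)=0$ otherwise. Empty products equal $1$. *)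

(* Defs.v *)
From HB Require Import structures.
From mathcomp Require Import all_boot all_order all_algebra.
From mathcomp Require Import all_classical all_reals all_analysis.
From mathcomp Require Import measurable_realfun.

Set Implicit Arguments.
Unset Strict Implicit.
Unset Printing Implicit Defensive.

Import Order.TTheory GRing.Theory Num.Theory.

Local Open Scope classical_set_scope.
Local Open Scope ring_scope.

(* The closed interval L = [a, b] of \bar R, with the order inherited from
   \bar R.  The proof of a <= b is a parameter because measurableType requires
   a point of L. *)
Definition cint (R : realType) (a b : \bar R) (hab : (a <= b)%E) : Type :=
  {x : \bar R | (a <= x <= b)%E}.

HB.instance Definition _ (R : realType) (a b : \bar R) (hab : (a <= b)%E) :=
  SubChoice.on (cint hab).
HB.instance Definition _ (R : realType) (a b : \bar R) (hab : (a <= b)%E) :=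
  [SubChoice_isSubOrder of cint hab by <: with ring_display].

Lemma cint_lo_subproof (R : realType) (a b : \bar R) (hab : (a <= b)%E) :
  (a <= a <= b)%E.
Proof. by rewrite lexx hab. Qed.

Lemma cint_hi_subproof (R : realType) (a b : \bar R) (hab : (a <= b)%E) :
  (a <= b <= b)%E.
Proof. by rewrite hab lexx. Qed.

Definition cint_lo (R : realType) (a b : \bar R) (hab : (a <= b)%E) :
  cint hab := exist _ a (cint_lo_subproof hab).

Definition cint_hi (R : realType) (a b : \bar R) (hab : (a <= b)%E) :
  cint hab := exist _ b (cint_hi_subproof hab).

HB.instance Definition _ (R : realType) (a b : \bar R) (hab : (a <= b)%E) :=
  isPointed.Build (cint hab) (cint_lo hab).

(* The sigma-algebra of L is the trace of the Borel sigma-algebra of \bar R. *)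
Definition cint_measurable (R : realType) (a b : \bar R) (hab : (a <= b)%E) :
  set (set (cint hab)) :=
  preimage_set_system setT (fun x : cint hab => (val x : \bar R))
    (measurable : set (set (\bar R))).

Lemma cint_sigma_algebra (R : realType) (a b : \bar R) (hab : (a <= b)%E) :
  sigma_algebra setT (@cint_measurable R a b hab).
Proof.
apply: sigma_algebra_preimage; split => //.
- by move=> A mA; rewrite setTD; exact: measurableC.
- by move=> F mF; exact: bigcupT_measurable.
Qed.

Lemma cint_measurable0 (R : realType) (a b : \bar R) (hab : (a <= b)%E) :
  @cint_measurable R a b hab set0.
Proof. by have [] := cint_sigma_algebra hab. Qed.

Lemma cint_measurableC (R : realType) (a b : \bar R) (hab : (a <= b)%E)
    (A : set (cint hab)) :
  cint_measurable A -> cint_measurable (~` A).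
Proof. by have [_ + _] := cint_sigma_algebra hab => /[apply]; rewrite setTD. Qed.

Lemma cint_measurable_bigcup (R : realType) (a b : \bar R) (hab : (a <= b)%E)
    (F : (set (cint hab))^nat) :
  (forall i, cint_measurable (F i)) -> cint_measurable (\bigcup_i F i).
Proof. by have [_ _] := cint_sigma_algebra hab; exact. Qed.

HB.instance Definition _ (R : realType) (a b : \bar R) (hab : (a <= b)%E) :=
  @isMeasurable.Build default_measure_display (cint hab)
    (@cint_measurable R a b hab) (cint_measurable0 hab)
    (@cint_measurableC R a b hab) (@cint_measurable_bigcup R a b hab).

Inductive weighted_lattice_poly (disp : Order.disp_t) (L : orderType disp)
    (n : nat) : (('I_n -> L) -> L) -> Prop :=
| wlp_proj (k : 'I_n) : weighted_lattice_poly (fun x => x k)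
| wlp_cst (c : L) : weighted_lattice_poly (fun _ => c)
| wlp_min (p q : ('I_n -> L) -> L) :
    weighted_lattice_poly p -> weighted_lattice_poly q ->
    weighted_lattice_poly (fun x => Order.min (p x) (q x))
| wlp_max (p q : ('I_n -> L) -> L) :
    weighted_lattice_poly p -> weighted_lattice_poly q ->
    weighted_lattice_poly (fun x => Order.max (p x) (q x)).

Definition charvec (R : realType) (a b : \bar R) (hab : (a <= b)%E) (n : nat)
    (S : {set 'I_n}) : 'I_n -> cint hab :=
  fun i => if i \in S then cint_hi hab else cint_lo hab.

Definition heaviside (R : realType) (x : \bar R) : R :=
  if (0 <= x)%E then 1 else 0.

(* [heaviside_at c y] is H_c(y); as y is finite, y - c is never an
   indeterminate form. *)
Definition heaviside_at (R : realType) (c : \bar R) (y : R) : R :=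
  heaviside (y%:E - c)%E.

(* Mutual independence: the product rule for every finite subfamily. *)
Definition independent_RVs (d d' : measure_display) (T : measurableType d)
    (T' : measurableType d') (R : realType) (P : probability T R) (I : finType)
    (X : I -> {RV P >-> T'}) : Prop :=
  forall (J : {set I}) (A : I -> set T'),
    (forall i, i \in J -> measurable (A i)) ->
    P (\bigcap_(i in [set` J]) (X i @^-1` A i)) =
    (\prod_(i in J) P (X i @^-1` A i))%E.

Arguments independent_RVs {d d' T T' R} P {I} X.

Definition cint_cdf (d : measure_display) (T : measurableType d)
    (R : realType) (P : probability T R) (a b : \bar R) (hab : (a <= b)%E)
    (X : {RV P >-> cint hab}) (y : R) : R :=
  fine (distribution P X [set x : cint hab | (val x <= y%:E)%E]).

Arguments cint_cdf {d T R} P {a b hab} X y.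

Lemma measurable_val_cint (R : realType) (a b : \bar R) (hab : (a <= b)%E) :
  measurable_fun setT (fun x : cint hab => (val x : \bar R)).
Proof. by move=> _ B mB; exists B. Qed.

Lemma measurable_to_cint (d : measure_display) (T : measurableType d)
    (R : realType) (a b : \bar R) (hab : (a <= b)%E) (f : T -> cint hab) :
  measurable_fun setT (fun w => (val (f w) : \bar R)) -> measurable_fun setT f.
Proof.
move=> mf _ B [C mC <-]; rewrite setTI.
by have := mf measurableT _ mC; rewrite !setTI.
Qed.

(* p(X_1, ..., X_n), as a random variable. *)
Definition wlp_rv (d : measure_display) (T : measurableType d) (R : realType)
    (P : probability T R) (a b : \bar R) (hab : (a <= b)%E) (n : nat)
    (p : ('I_n -> cint hab) -> cint hab) (hp : weighted_lattice_poly p)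
    (X : 'I_n -> {RV P >-> cint hab}) : T -> cint hab :=
  fun w => p (fun i => X i w).

Lemma wlp_rv_measurable (d : measure_display) (T : measurableType d)
    (R : realType) (P : probability T R) (a b : \bar R) (hab : (a <= b)%E)
    (n : nat) (p : ('I_n -> cint hab) -> cint hab)
    (hp : weighted_lattice_poly p) (X : 'I_n -> {RV P >-> cint hab}) :
  measurable_fun setT (wlp_rv hp X).
Proof.
rewrite /wlp_rv.
have valmin (x y : cint hab) : val (Order.min x y) = mine (val x) (val y).
  by rewrite /Order.min -fun_if.
have valmax (x y : cint hab) : val (Order.max x y) = maxe (val x) (val y).
  by rewrite /Order.max -fun_if.
elim: hp => [k|c|q r _ mq _ mr|q r _ mq _ mr].
- exact: measurable_funPT.
- exact: measurable_cst.
- apply: measurable_to_cint; under eq_fun do rewrite valmin.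
  apply: measurable_mine.
  + exact: measurableT_comp (@measurable_val_cint _ _ _ hab) mq.
  + exact: measurableT_comp (@measurable_val_cint _ _ _ hab) mr.
- apply: measurable_to_cint; under eq_fun do rewrite valmax.
  apply: measurable_maxe.
  + exact: measurableT_comp (@measurable_val_cint _ _ _ hab) mq.
  + exact: measurableT_comp (@measurable_val_cint _ _ _ hab) mr.
Qed.

HB.instance Definition _ (d : measure_display) (T : measurableType d)
    (R : realType) (P : probability T R) (a b : \bar R) (hab : (a <= b)%E)
    (n : nat) (p : ('I_n -> cint hab) -> cint hab)
    (hp : weighted_lattice_poly p) (X : 'I_n -> {RV P >-> cint hab}) :=
  isMeasurableFun.Build _ _ _ _ (wlp_rv hp X) (wlp_rv_measurable hp X).

(* Main.v *)
(* The event p(x) <= y depends on x only through the set S of the indices i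
   with x_i > y, and on that set it agrees with p(e_S) <= y: this is clear for
   projections and constants and passes through min and max.  Hence
   {Y_p <= y} is the disjoint union, over the S with p(e_S) <= y, of the events
   "exactly the X_i with i in S exceed y", whose probabilities are the products
   of the formulas by independence.  The second formula sums these; the first
   one uses in addition that they sum to 1 over all S. *)
Require Import Defs.
From HB Require Import structures.
From mathcomp Require Import all_boot all_order all_algebra.
From mathcomp Require Import all_classical all_reals all_analysis.
From mathcomp Require Import measurable_realfun.

Set Implicit Arguments.
Unset Strict Implicit.
Unset Printing Implicit Defensive.

Import Order.TTheory GRing.Theory Num.Theory.

Local Open Scope ring_scope.

Lemma heaviside_atE (R : realType) (c : \bar R) (y : R) :
  heaviside_at c y = (c <= y%:E)%E%:R.
Proof. by rewrite /heaviside_at /heaviside sube_ge0 ?orbT//; case: ifP. Qed.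

Lemma wlp_le_charvec (R : realType) (a b : \bar R) (hab : (a <= b)%E) (n : nat)
    (p : ('I_n -> cint hab) -> cint hab) (hp : weighted_lattice_poly p)
    (x : 'I_n -> cint hab) (y : \bar R) :
  (val (p x) <= y)%E =
  (val (p (charvec hab [set i | ~~ (val (x i) <= y)%E])) <= y)%E.
Proof.
have valmin (u v : cint hab) : val (Order.min u v) = mine (val u) (val v).
  by rewrite /Order.min -fun_if.
have valmax (u v : cint hab) : val (Order.max u v) = maxe (val u) (val v).
  by rewrite /Order.max -fun_if.
elim: hp => [k|//|q r _ IHq _ IHr|q r _ IHq _ IHr].
(* If [x k] is at most [y], this component of [charvec] is [a], and a <= x_k <= y. Otherwise it is
   [b], and b <= y would force x_k <= y. *)
- rewrite /charvec inE; have /andP[ax xb] := valP (x k).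
  case: (boolP (val (x k) <= y)%E) => /= [xy|xy].
  + by rewrite (le_trans ax xy).
  + by apply/esym/negbTE; apply: contra xy; apply: le_trans.
- by rewrite !valmin !ge_min IHq IHr.
- by rewrite !valmax !ge_max IHq IHr.
Qed.

(** Finite additivity over the fibres of [f], which are pairwise disjoint. *)
Lemma probability_fin_partition (d : measure_display) (T : measurableType d)
    (R : realType) (P : probability T R) (I : finType) (f : T -> I)
    (mf : forall i, measurable [set w | f w = i]%classic) (Q : pred I) :
  P [set w | Q (f w)]%classic = (\sum_(i | Q i) P [set w | f w = i]%classic)%E.
Proof.
have -> : [set w | Q (f w)]%classic =
          (\bigcup_(i in [set` Q]) [set w | f w = i])%classic.
  apply/seteqP; split=> [w Qw|w [i + fwi]]; first by exists (f w).
  by rewrite /= -[i]fwi.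
rewrite measure_fin_bigcup//; last by move=> i j _ _ [w [/= <- <-]].
(* The sum over a classical set becomes a big sum over [I], since [index_enum I] lists each index
   exactly once. *)
rewrite -(@bigfs _ _ _ _ (index_enum I))//; first exact: index_enum_uniq.
by move=> i _; rewrite mem_index_enum.
Qed.

Section IndependentRVs.
Variables (d d' : measure_display) (T : measurableType d).
Variables (T' : measurableType d') (R : realType) (P : probability T R).
Variables (I : finType) (X : I -> {RV P >-> T'}).

(** An intersection over the full index set, with one condition per index, is the form to which
    [independent_RVs] applies with [J] all of [I]. *)
Lemma exceedance_setE (D : pred T') (S : {set I}) :
  [set w | [set i | ~~ D (X i w)]%SET = S]%classic =
  (\bigcap_(i in [set` [set: I]%SET])
    (X i @^-1` (if i \in S then ~` [set` D] else [set` D])))%classic.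
Proof.
apply/seteqP; split=> w /=.
- by move=> <- i _; rewrite /= inE; case: ifPn => //=; [move/negP|rewrite negbK].
- move=> h; apply/setP => i; rewrite inE.
  by have := h i (finset.in_setT i); case: (i \in S) => /=; [move/negP|rewrite unfold_in => ->].
Qed.

Lemma measurable_exceedance_set (D : pred T') (S : {set I}) :
  measurable [set` D]%classic ->
  measurable [set w | [set i | ~~ D (X i w)]%SET = S]%classic.
Proof.
move=> mD; rewrite exceedance_setE; apply: fin_bigcap_measurable => // i _.
by apply: measurable_funPTI; case: ifP => // _; exact: measurableC.
Qed.

Lemma probability_exceedance_set (D : pred T') (S : {set I}) :
  independent_RVs P X -> measurable [set` D]%classic ->
  let F i := fine (distribution P (X i) [set` D]%classic) in
  P [set w | [set i | ~~ D (X i w)]%SET = S]%classic =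
  ((\prod_(i in ~: S) F i) * \prod_(i in S) (1 - F i))%:E.
Proof.
move=> hX mD F; rewrite exceedance_setE hX; last first.
  by move=> i _; case: ifP => // _; exact: measurableC.
have mXD i : measurable (X i @^-1` [set` D])%classic by exact: measurable_funPTI.
have FE i : P (X i @^-1` [set` D])%classic = (F i)%:E.
  by rewrite fineK// fin_num_measure.
(* Indices in [S] carry the complement of [D], hence a factor 1 - F_i; the others carry [D]
   itself. *)
rewrite (bigID (mem S)) /= muleC EFinM -!prodEFin; congr (_ * _)%E.
- by apply: eq_big => [i|i /andP[_ /negbTE->]//]; rewrite !inE.
- apply: eq_big => [i|i /andP[_ /= ->]]; first by rewrite inE.
  by rewrite preimage_setC probability_setC ?FE //; exact: mXD.
Qed.

End IndependentRVs.

Theorem theorem6 (R : realType) (a b : \bar R) (hab : (a <= b)%E)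
    (n : nat) (hn : (1 <= n)%N)
    (p : ('I_n -> cint hab) -> cint hab) (hp : weighted_lattice_poly p)
    (d : measure_display) (T : measurableType d) (P : probability T R)
    (X : 'I_n -> {RV P >-> cint hab}) (hX : independent_RVs P X) (y : R) :
  cint_cdf P (wlp_rv hp X) y =
    1 - \sum_(S : {set 'I_n})
          (1 - heaviside_at (val (p (charvec hab S))) y) *
          (\prod_(i in ~: S) cint_cdf P (X i) y) *
          (\prod_(i in S) (1 - cint_cdf P (X i) y))
  /\
  cint_cdf P (wlp_rv hp X) y =
    \sum_(S : {set 'I_n})
       heaviside_at (val (p (charvec hab (~: S)))) y *
       (\prod_(i in S) cint_cdf P (X i) y) *
       (\prod_(i in ~: S) (1 - cint_cdf P (X i) y)).
Proof.
pose D : pred (cint hab) := fun x => (val x <= y%:E)%E.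
have mD : measurable [set` D]%classic.
  rewrite -[X in measurable X]setTI; apply: measurable_lee => //.
  exact: measurable_val_cint.
(* [exc w] is the random set of indices whose variable exceeds [y]; [G] is shown to be its law. *)
pose exc w := [set i | ~~ D (X i w)]%SET.
pose G (S : {set 'I_n}) := (\prod_(i in ~: S) cint_cdf P (X i) y) *
  \prod_(i in S) (1 - cint_cdf P (X i) y).
have sumG (Q : pred {set 'I_n}) :
    P [set w | Q (exc w)]%classic = (\sum_(S | Q S) G S)%:E.
  rewrite probability_fin_partition => [|S]; last exact: measurable_exceedance_set.
  by rewrite -sumEFin; apply: eq_bigr => S _; exact: probability_exceedance_set.
have sumG1 : \sum_S G S = 1.
  apply: EFin_inj; rewrite -(sumG predT) -[RHS](@probability_setT _ _ _ P).
  by congr (P _); apply/seteqP; split.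
have cdfE : cint_cdf P (wlp_rv hp X) y =
    \sum_S heaviside_at (val (p (charvec hab S))) y * G S.
  (* The 0/1 Heaviside weights only select the [S] with p(e_S) <= y, so [sumG] applies. *)
  under eq_bigr do rewrite heaviside_atE mulr_natl mulrb.
  rewrite -big_mkcond /= -[RHS]/(fine _%:E) -sumG; congr (fine (P _)).
  by apply/seteqP; split=> w /=;
    rewrite /wlp_rv (wlp_le_charvec hp (fun i => X i w)).
split; rewrite cdfE.
(* With 1 written as the total mass of [G], the identity is termwise: H G = G - (1 - H) G. *)
- rewrite -[X in X - _]sumG1 -sumrB; apply: eq_bigr => S _.
  by rewrite -mulrA mulrBl mul1r subKr.
(* Here [S] stands for the indices with X_i <= y, the complement of the exceedance set. *)
- rewrite (reindex_inj (@finset.setC_inj _)) /=; apply: eq_bigr => S _.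
  by rewrite /G finset.setCK mulrA.
Qed.
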